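(* There exists $K>0$ such that for every $\epsilon>0$ the set $$\Big\{x\in(\tfrac34,\infty)\ \Big|\ \Big(\frac{1}{1-\frac{\log_2 3}{2}}-\epsilon\Big)\log_2 x\leq \tau_K(x)\leq \Big(\frac{1}{1-\frac{\log_2 3}{2}}+\epsilon\Big)\log_2 x\Big\}$$ has real density $1$.
   Context: For $x\in\mathbb R$ let $[x]$ be the unique integer with $x-[x]\in(-\frac12,\frac12]$. The map $C_{\mathbb R}$ is defined by $C_{\mathbb R}(x)=\frac{x}{2}$ if $[x]$ is even and $C_{\mathbb R}(x)=\frac{3x}{2}$ if $[x]$ is odd; it maps $(0,\infty)$ to itself, and $C_{\mathbb R}^n$ is its $n$-th iterate. $\mathbb N$ includes $0$. For $K>0$ and $x\in(\frac34,\infty)$ the stopping time $\tau_K(x)$ is the minimal $n\in\mathbb N$ with $C_{\mathbb R}^n(x)\leq K$ if such $n$ exists, and $\tau_K(x)=\infty$ otherwise. Let $\lambda$ be Lebesgue measure. A (measurable) set $A\subseteq\mathbb R$ has real density $\alpha\in[0,1]$ if for every $\eta>0$ there exists $R_0>0$ such that $\left|\frac{\lambda(A\cap(0,R))}{R}-\alpha\right|<\eta$ for all $R\geq R_0$. *)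

(* Defs.v *)
From HB Require Import structures.
From mathcomp Require Import all_boot all_order all_algebra.
From mathcomp Require Import all_classical all_reals all_analysis.
From mathcomp Require Import lra.

Set Implicit Arguments.
Unset Strict Implicit.
Unset Printing Implicit Defensive.

Import Order.TTheory GRing.Theory Num.Theory.
Import numFieldNormedType.Exports.

Local Open Scope classical_set_scope.
Local Open Scope ring_scope.

(* Half-integers are rounded down; see nearest_intP. *)
Definition nearest_int {R : realType} (x : R) : int := Num.ceil (x - 2^-1).

Lemma nearest_intP {R : realType} (x : R) (m : int) :
  (- 2^-1 < x - m%:~R <= 2^-1) <-> nearest_int x = m.
Proof.
rewrite /nearest_int; split=> [/andP[h1 h2]|<-].
  apply: ceil_def; rewrite intrB mulr1z; apply/andP; split.
    by lra.
  by lra.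
have /andP[] := ceil_itv (x - 2^-1 : R); rewrite intrB mulr1z => h1 h2.
by apply/andP; split; lra.
Qed.

Definition collatzR {R : realType} (x : R) : R :=
  if (2 %| nearest_int x)%Z then x / 2 else 3 * x / 2.

Definition stopping_time {R : realType} (K x : R) : \bar R :=
  match pselect (exists n, iter n collatzR x <= K) with
  | left ex_n => ((ex_minn ex_n)%:R)%:E
  | right _ => +oo%E
  end.

Definition log2 {R : realType} (x : R) : R := ln x / ln 2.

(* The measure below is at most r, so taking its real value with fine is
   harmless. *)
Definition has_real_density {R : realType} (A : set R) (alpha : R) : Prop :=
  measurable A /\
  forall eta : R, 0 < eta ->
    exists2 r0 : R, 0 < r0 &
      forall r : R, r0 <= r ->
        `| fine (lebesgue_measure (A `&` `]0, r[)) / r - alpha | < eta.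

(* Main.v *)
(* The map C is piecewise linear without additive constant, so C^n x equals
   3^S x / 2^n, where S = S_n(x) counts the odd steps. Three facts follow.

   (1) For fixed z and odd c, the numbers z + c k (k < 2^L) realise each parity
   vector of length L exactly once. Hence S_L is binomially distributed on
   ]0, c 2^L[, and Chernoff's bound gives S_L ~ L / 2 outside a set of relative
   measure theta^L with theta < 1.

   (2) C maps a fiber x 3^Z to the fiber (x / 2) 3^Z and preserves its order.
   So once C^n x lies below a given height, its orbit is dominated by that of the
   largest point below this height in the fiber of x / 2^n, which depends on x
   through a mere dilation. This makes it possible to apply (1) to successive
   blocks without any equidistribution result for the orbit: each block of L
   steps brings the height from 2^L to about 3^(L/2), and the exceptional sets
   have densities summing to O(theta^L0) when the descent stops at height 2^L0.
   The lower bound is obtained in the same way from the smallest points above a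
   height.

   (3) The set of x whose fiber contains a point that never comes below K is
   invariant under multiplication by 2 and by 3. As 2 and 3 generate a dense
   group, its measure is proportional to that of intervals, and Lebesgue's
   density theorem makes it null or conull. By (2) its density is less than 1
   if K is large, so it is null; hence the descent from height 2^L0 to K takes
   bounded time off a set of small density. *)
Require Import Defs.
From HB Require Import structures.
From mathcomp Require Import all_boot all_order all_algebra.
From mathcomp Require Import all_classical all_reals all_analysis.
From mathcomp Require Import measurable_realfun.
From mathcomp Require Import ring lra zify.

Set Implicit Arguments.
Unset Strict Implicit.
Unset Printing Implicit Defensive.

Import Order.TTheory GRing.Theory Num.Theory.
Import numFieldNormedType.Exports.

Local Open Scope classical_set_scope.
Local Open Scope ring_scope.

(** * Dynamics along fibers *)

Section dynamics.
Context {R : realType}.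
Implicit Types (x y z w : R) (c n j : nat).

Definition is_odd x : bool := ~~ (2 %| nearest_int x)%Z.

Definition odd_steps n x : nat := \sum_(i < n) is_odd (iter i collatzR x).

Lemma collatzRE x : collatzR x = 3 ^+ is_odd x * x / 2.
Proof.
by rewrite /collatzR /is_odd; case: ifP => _ /=; rewrite ?expr0 ?expr1 ?mul1r.
Qed.

Lemma odd_steps0 x : odd_steps 0 x = 0%N.
Proof. by rewrite /odd_steps big_ord0. Qed.

Lemma odd_stepsS n x :
  odd_steps n.+1 x = (is_odd x + odd_steps n (collatzR x))%N.
Proof.
rewrite /odd_steps big_ord_recl /=; congr addn.
by apply: eq_bigr => i _; rewrite -iterSr.
Qed.

Lemma iter_collatzRE n x : iter n collatzR x = 3 ^+ odd_steps n x * x / 2 ^+ n.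
Proof.
elim: n x => [|n IH] x; first by rewrite odd_steps0 !expr0 mul1r divr1.
rewrite iterSr IH odd_stepsS collatzRE exprD !exprS.
by rewrite invfM; ring.
Qed.

Lemma iter_collatzR_gt0 n x : 0 < x -> 0 < iter n collatzR x.
Proof.
by move=> x0; rewrite iter_collatzRE divr_gt0 ?mulr_gt0 ?exprn_gt0.
Qed.

Lemma iter_collatzR_ge n x : 0 < x -> x / 2 ^+ n <= iter n collatzR x.
Proof.
move=> x0; rewrite iter_collatzRE ler_pM2r ?invr_gt0 ?exprn_gt0//.
by rewrite ler_peMl ?exprn_ege1 ?ler1n// ltW.
Qed.

Lemma is_odd_add x c : is_odd (x + c%:R) = is_odd x (+) odd c.
Proof.
rewrite /is_odd; have -> : nearest_int (x + c%:R) = nearest_int x + c%:Z.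
  have /nearest_intP h := erefl (nearest_int x).
  apply/nearest_intP; rewrite intrD -pmulrn.
  by move: h => /andP[h1 h2]; apply/andP; split; lra.
lia.
Qed.

(* For fixed z, exactly half of the points z + c k (c odd, k < 2 ^ n.+1) take an
   odd first step, and the images of each half under the map again form an
   arithmetic progression with odd difference: c if the step is even, 3 c if it
   is odd. *)
Lemma odd_steps_gen n w z c : odd c ->
  \sum_(k < 2 ^ n) w ^+ odd_steps n (z + (c * k)%:R) = (1 + w) ^+ n.
Proof.
elim: n z c => [|n IH] z c oc.
  by rewrite expn0 big_ord1 odd_steps0 !expr0.
have half (u : R) : \sum_(k < 2 ^ n) w ^+ odd_steps n.+1 (u + (c * (2 * k))%:R)
    = w ^+ is_odd u * (1 + w) ^+ n.
  pose d := if is_odd u then (3 * c)%N else c.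
  have od : odd d by rewrite /d; case: ifP => _ //; rewrite oddM oc.
  rewrite -(IH (3 ^+ is_odd u * u / 2) d od) big_distrr /=.
  apply: eq_bigr => k _.
  rewrite odd_stepsS exprD collatzRE is_odd_add !oddM /= andbF addbF.
  congr (_ * _ ^+ odd_steps n _); rewrite /d !natrM.
  by case: (is_odd u) => /=; rewrite ?expr0 ?expr1 ?natrM; field.
rewrite expnS mulnC -(big_mkord xpredT
  (fun k => w ^+ odd_steps n.+1 (z + (c * k)%:R))) big_nat_mul /=.
rewrite (eq_bigr (fun i => w ^+ odd_steps n.+1 (z + (c * (2 * i))%:R)
    + w ^+ odd_steps n.+1 (z + c%:R + (c * (2 * i))%:R))); last first.
  move=> i _; rewrite mulSn !addSn add0n big_ltn ?leqnSn// big_ltn// big_geq//.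
  by rewrite addr0 (mulnC i) mulnS natrD addrA.
rewrite big_mkord big_split/= !half is_odd_add oc addbT exprS.
by case: (is_odd z) => /=; rewrite ?expr0 ?expr1; ring.
Qed.

(** The exponent [i] is natural: the parities of the two points change it by at most one, and for
    [j > 0] the factor 3 already present pays for this. Hence the order along fibers is
    preserved. *)
Lemma collatzR_mul3 x j : exists i, collatzR (3 ^+ j * x) = 3 ^+ i * collatzR x.
Proof.
case: j => [|j]; first by exists 0%N; rewrite !expr0 !mul1r.
exists (j.+1 + is_odd (3 ^+ j.+1 * x)%R - is_odd x)%N.
rewrite !collatzRE; apply: (@mulIf _ 2); first by rewrite pnatr_eq0.
rewrite !mulrA !mulfVK ?pnatr_eq0//.
rewrite -!exprD; congr (_ ^+ _ * x).
by move: (is_odd x) (is_odd _); move=> [] []; lia.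
Qed.

Lemma iter_collatzR_mul3 n x j :
  exists i, iter n collatzR (3 ^+ j * x) = 3 ^+ i * iter n collatzR x.
Proof.
elim: n j x => [|n IH] j x; first by exists j.
by rewrite !iterSr; have [i ->] := collatzR_mul3 x j; exact: IH.
Qed.

Lemma iter_collatzR_le n x j : 0 < x ->
  iter n collatzR x <= iter n collatzR (3 ^+ j * x).
Proof.
move=> x0; have [i ->] := iter_collatzR_mul3 n x j.
by rewrite ler_peMl ?exprn_ege1 ?ler1n// ltW// iter_collatzR_gt0.
Qed.

End dynamics.

(** * Lebesgue measure of initial segments *)

Section affine.
Context {R : realType}.
Implicit Types (A B : set R) (g b r : R).
Local Notation mu := (@lebesgue_measure R).

Lemma measurable_affine g b : measurable_fun [set: R] (fun x : R => g * x + b).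
Proof.
apply: measurable_funD; last exact: measurable_cst.
by apply: measurable_funM; [exact: measurable_cst|exact: measurable_id].
Qed.

Lemma measurable_preimage (f : R -> R) A : measurable_fun [set: R] f ->
  measurable A -> measurable (f @^-1` A).
Proof. by move=> mf mA; rewrite -[X in measurable X]setTI; exact: mf. Qed.

(** By uniqueness of Lebesgue measure: the rescaled pushforward takes the right values on the
    intervals []c, d]]. *)
Lemma lebesgue_measure_affine g b A : 0 < g -> measurable A ->
  (g%:E * mu ((fun x : R => g * x + b)%R @^-1` A))%E = mu A.
Proof.
move=> g0 mA.
pose f : R -> measurableTypeR R := fun x => g * x + b.
have mf : measurable_fun [set: measurableTypeR R] f := measurable_affine g b.
have g0' : 0 <= g by exact: ltW.
rewrite (@lebesgue_measure_unique R
  (mscale (NngNum g0') (pushforward mu f)) _ A mA)//.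
move=> _ [[c d]] _ <-; rewrite /= /mscale /pushforward/=.
rewrite -[pushforward _ _ _]/(mu (f @^-1` `]c, d])).
rewrite (_ : f @^-1` `]c, d] = `](c - b) / g, (d - b) / g]%classic); last first.
  apply/seteqP; split => x /=; rewrite !in_itv/= ltr_pdivrMr// ler_pdivlMr// /f;
    by rewrite ltrBlDr lerBrDr mulrC.
rewrite !lebesgue_measure_itv/= !lte_fin ltr_pM2r ?invr_gt0// ltrD2r.
case: ifP => // _; last by rewrite mule0.
by rewrite -EFinD -EFinM; congr EFin; field; rewrite gt_eqF.
Qed.

Definition mass A r : R := fine (mu (A `&` `]0, r[)).

Lemma measurableI_itv A r : measurable A -> measurable (A `&` `]0, r[).
Proof. by move=> mA; apply: measurableI => //; exact: measurable_itv. Qed.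

Lemma lebesgue_measure0_itv (r : R) : 0 <= r -> mu `]0, r[ = r%:E.
Proof.
rewrite le_eqVlt => /predU1P[<-|r0].
  by rewrite lebesgue_measure_itv/= lte_fin ltxx.
by rewrite lebesgue_measure_itv/= lte_fin r0 oppr0 adde0.
Qed.

Lemma massE A r : measurable A -> (mass A r)%:E = mu (A `&` `]0, r[).
Proof.
move=> mA; rewrite /mass fineK// ge0_fin_numE; last exact: measure_ge0.
apply: (@le_lt_trans _ _ (mu `]0, r[)).
  by apply: le_measure; rewrite ?inE//; exact: measurableI_itv.
by rewrite lebesgue_measure_itv; case: ifP => _; rewrite ?ltry// -EFinB ltry.
Qed.

Lemma mass_ge0 A r : 0 <= mass A r.
Proof. by rewrite /mass fine_ge0//; exact: measure_ge0. Qed.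

Lemma le_mass A B r s : measurable A -> measurable B ->
  A `&` `]0, r[ `<=` B `&` `]0, s[ -> mass A r <= mass B s.
Proof.
move=> mA mB AB; rewrite -lee_fin !massE//.
by apply: le_measure; rewrite ?inE//; exact: measurableI_itv.
Qed.

Lemma mass_setT r : 0 <= r -> mass setT r = r.
Proof. by move=> r0; rewrite /mass setTI lebesgue_measure0_itv. Qed.

Lemma mass_le A r : measurable A -> 0 <= r -> mass A r <= r.
Proof.
move=> mA r0; rewrite -[leRHS](mass_setT r0); apply: le_mass => //.
by apply: setSI; exact: subsetT.
Qed.

Lemma massU A B r : measurable A -> measurable B ->
  mass (A `|` B) r <= mass A r + mass B r.
Proof.
move=> mA mB; rewrite -lee_fin EFinD !massE//; last exact: measurableU.
rewrite setIUl; apply: measureU2; exact: measurableI_itv.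
Qed.

Lemma mass_scale g A r : 0 < g -> measurable A ->
  mass ((fun x => g * x) @^-1` A) r = mass A (g * r) / g.
Proof.
move=> g0 mA.
have mB : measurable ((fun x : R => g * x) @^-1` A).
  by apply: measurable_preimage => //; apply: measurable_funM.
apply: (@mulIf _ g); first by rewrite gt_eqF.
rewrite mulfVK ?gt_eqF// mulrC; apply: EFin_inj.
rewrite EFinM !massE// -(lebesgue_measure_affine 0 g0 (measurableI_itv _ mA)).
congr (_ * mu _)%E; apply/seteqP; split => x /=; rewrite !in_itv/= addr0;
  by rewrite (ltr_pM2l g0) (pmulr_rgt0 _ g0).
Qed.

(** Cut the segment into [N] windows of length [c], translate each to [[0, c[] and exchange sum and
    integral: the pointwise bound [d] is then integrated over a single window. *)
Lemma mass_progression A (c N : nat) (d : R) : measurable A ->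
  (forall z, \sum_(k < N) (\1_A (z + (c * k)%:R) : R) <= d) ->
  mass A (c * N)%:R <= c%:R * d.
Proof.
move=> mA Ad.
pose B k := (fun x : R => 1 * x + (c * k)%:R) @^-1` A.
have mB k : measurable (B k).
  exact: measurable_preimage (measurable_affine _ _) mA.
pose F k := A `&` `[(c * k)%:R, (c * k)%:R + c%:R[ : set R.
have mF k : measurable (F k) by apply: measurableI => //; exact: measurable_itv.
have muF k : mu (F k) = mu (B k `&` `[0, c%:R[).
  rewrite -(lebesgue_measure_affine (c * k)%:R ltr01 (mF k)) mul1e.
  congr mu; apply/seteqP; split => x; rewrite /F /B/= !in_itv/= mul1r.
    by rewrite lerDr (addrC x) ltrD2l.
  by rewrite lerDr (addrC x) ltrD2l.
rewrite -lee_fin massE// EFinM.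
apply: (@le_trans _ _ (\sum_(k < N) mu (F k))%E).
  apply: (@content_subadditive _ _ _ mu _ F N).
  - by move=> k _; exact: mF.
  - exact: measurableI_itv.
  move=> x [Ax]; rewrite /= in_itv/= => /andP[x0 xN].
  have c0 : (0 < c)%N.
    rewrite lt0n; apply/eqP => c0; move: xN.
    by rewrite c0 mul0n ltNge (ltW x0).
  have c0R : 0 < c%:R :> R by rewrite ltr0n.
  have /truncn_itv : 0 <= x / c%:R by rewrite divr_ge0// ltW.
  set k := Num.truncn _.
  rewrite ler_pdivlMr// ltr_pdivrMr// => /andP[kx xk].
  rewrite -bigcup_mkord; exists k => /=.
    rewrite -(ltr_nat R) -(ltr_pM2l c0R) -[ltRHS]natrM (le_lt_trans _ xN)//.
    by rewrite mulrC.
  split => //; rewrite /= in_itv/= natrM (mulrC c%:R) kx/=.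
  by rewrite mulrSr mulrDl mul1r in xk.
have mG k : measurable_fun (`[0, c%:R[ : set R) (EFin \o \1_(B k)).
  by apply/measurable_EFinP; exact: measurable_indic.
have m0 : measurable (`[0, c%:R[ : set R) by exact: measurable_itv.
rewrite (eq_bigr (fun k : 'I_N =>
    (\int[mu]_(x in `[0%R, c%:R[) (\1_(B k) x)%:E)%E)); last first.
  move=> k _; rewrite muF.
  by apply/esym; apply: (@integral_indic _ _ _ mu _ m0 _ (mB k)).
apply: (@le_trans _ _
    (\int[mu]_(x in `[0%R, c%:R[) (\sum_(k < N) (\1_(B k) x)%:E))%E).
  rewrite ge0_integral_sum// => k; exact: mG.
apply: (@le_trans _ _ (\int[mu]_(x in `[0%R, c%:R[) (cst d%:E x))%E).
  apply: ge0_le_integral => //.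
  - by move=> x _; apply: sume_ge0.
  - by apply: emeasurable_sum => k; exact: mG.
  - move=> x _; rewrite sumEFin lee_fin; apply: le_trans (Ad x).
    apply: ler_sum => k _; rewrite /B !indicE/=.
    by rewrite -[X in X + _]mul1r.
rewrite [leLHS](_ : _ = (d%:E * mu (`[0, c%:R[)%classic%R)%E); last first.
  by rewrite -integral_cst.
rewrite lebesgue_measure_itv/= lte_fin oppr0 adde0 muleC.
case: ifPn => // c0; move: c0; rewrite ltr0n lt0n negbK => /eqP ->.
by rewrite mul0e.
Qed.
End affine.

(** * Sparse sets and fibers *)

Section sparse.
Context {R : realType}.
Implicit Types (A B : set R) (e g r x M : R) (k : int).

(* Bounding through a measurable hull dispenses with the measurability of A. *)
Definition sparse A e :=
  exists B, [/\ measurable B, A `<=` B & forall r, 0 < r -> mass B r <= e * r].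

Lemma sparse0 e : 0 <= e -> sparse set0 e.
Proof.
move=> e0; exists set0; split => // r r0.
by rewrite /mass set0I measure0/= mulr_ge0// ltW.
Qed.

Lemma sparseU A B e g : sparse A e -> sparse B g -> sparse (A `|` B) (e + g).
Proof.
move=> [A' [mA AA' hA]] [B' [mB BB' hB]]; exists (A' `|` B'); split.
- exact: measurableU.
- exact: setUSS.
- by move=> r r0; rewrite (le_trans (massU _ mA mB))// mulrDl lerD ?hA ?hB.
Qed.

Lemma sparse_sub A B e g : A `<=` B -> e <= g -> sparse B e -> sparse A g.
Proof.
move=> AB eg [B' [mB BB' hB]]; exists B'; split => //.
  exact: subset_trans BB'.
by move=> r r0; rewrite (le_trans (hB _ r0))// ler_wpM2r// ltW.
Qed.

(** The bound in [sparse] holds at every scale [r], so a dilation keeps the same constant. An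
    exceptional set for [x / 2 ^+ L] can thus be pulled back to [x]. *)
Lemma sparse_scale A e g : 0 < g -> sparse A e ->
  sparse ((fun x => x / g) @^-1` A) e.
Proof.
move=> g0 [B [mB AB hB]]; exists ((fun x => g^-1 * x) @^-1` B); split.
- by apply: measurable_preimage => //; apply: measurable_funM.
- by move=> x Ax /=; rewrite mulrC; exact: AB.
- move=> r r0; rewrite mass_scale ?invr_gt0// invrK.
  rewrite -ler_pdivlMr// (le_trans (hB _ _))//; first by rewrite mulr_gt0 ?invr_gt0.
  by rewrite mulrA mulrAC.
Qed.

Lemma exprz3_gt0 k : 0 < 3 ^ k :> R.
Proof. by rewrite exprz_gt0. Qed.

Lemma exprz_between (b x M : R) : 1 < b -> 0 < x -> 0 < M ->
  exists k : int, M / b <= b ^ k * x < M.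
Proof.
move=> b1 x0 M0; pose u := ln (M / x) / ln b; pose k := Num.ceil u - 1.
have b0 : 0 < b by exact: lt_trans b1.
have lb : 0 < ln b by rewrite ln_gt0.
have Mx : M / x = expR (u * ln b).
  by rewrite /u mulfVK ?gt_eqF// lnK// posrE divr_gt0.
have eb (i : int) : b ^ i = expR (i%:~R * ln b) :> R.
  by rewrite -powR_intmul ?ltW// /powR gt_eqF.
have /andP[h1 h2] : k%:~R < u <= (k + 1)%:~R.
  by rewrite /k subrK; exact: ceil_itv.
exists k; rewrite -ler_pdivrMr// -ltr_pdivlMr// mulrAC Mx eb.
rewrite ltr_expR ltr_pM2r// h1 andbT ler_pdivrMr//.
rewrite -[X in _ <= _ * X]lnK ?posrE// -expRD ler_expR.
by rewrite -[X in _ + X]mul1r -mulrDl ler_pM2r// -(intrD _ _ 1).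
Qed.

Lemma fiber_point x M : 0 < x -> 0 < M -> exists k, M / 3 <= 3 ^ k * x < M.
Proof. by apply: exprz_between; rewrite ltr1n. Qed.

Definition mul_stable g A := forall x, 0 < x -> A (g * x) <-> A x.

Lemma mass_mul g A r : 0 < g -> measurable A -> mul_stable g A ->
  mass A (g * r) = g * mass A r.
Proof.
move=> g0 mA Ag; have := mass_scale r g0 mA.
have -> : mass ((fun x => g * x) @^-1` A) r = mass A r.
  rewrite /mass; congr (fine (lebesgue_measure _)).
  apply/seteqP; split => x []/= Ax; rewrite in_itv/= => xr; split => //;
    by apply/Ag => //; case/andP: xr.
by move=> ->; rewrite mulrCA divff ?mulr1// gt_eqF.
Qed.

Lemma mass_expz3 A r k : measurable A -> mul_stable 3 A ->
  mass A (3 ^ k * r) = 3 ^ k * mass A r.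
Proof.
move=> mA A3.
have nat_case n s : mass A (3 ^+ n * s) = 3 ^+ n * mass A s.
  by elim: n => [|n IH]; rewrite ?expr0 ?mul1r// exprS -!mulrA mass_mul// IH.
case: k => n; first exact: nat_case.
rewrite NegzE -exprnN.
have n3 : 3 ^+ n.+1 != 0 :> R by rewrite expf_neq0.
by apply: (mulfI n3); rewrite -nat_case !mulrA divff// !mul1r.
Qed.

(** Some [3 ^ k * r] lies in [[M / 3, M[], where the mass is at most that at [M]; comparing the two
    lengths costs the factor 3. One scale thus controls all. *)
Lemma mass_mul3_stable A r M : measurable A -> mul_stable 3 A -> 0 < r -> 0 < M ->
  mass A r <= 3 * mass A M / M * r.
Proof.
move=> mA A3 r0 M0; have [k /andP[k1 k2]] := fiber_point r0 M0.
have k0 := exprz3_gt0 k.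
have rE : mass A r = mass A (3 ^ k * r) / 3 ^ k.
  by rewrite mass_expz3// mulrAC divff ?mul1r// gt_eqF.
rewrite rE ler_pdivrMr//.
have h : mass A (3 ^ k * r) <= mass A M.
  apply: le_mass => // x [Ax]; rewrite /= !in_itv/= => /andP[-> xr].
  by split => //; exact: lt_trans k2.
apply: (le_trans h).
have -> : 3 * mass A M / M * r * 3 ^ k = mass A M * (3 * (3 ^ k * r) / M) by ring.
rewrite ler_peMr ?mass_ge0// ler_pdivlMr// mul1r mulrC.
by rewrite -ler_pdivrMr.
Qed.

Definition fiber A : set R := [set x | 0 < x /\ exists k, A (3 ^ k * x)].

Lemma measurable_fiber A : measurable A -> measurable (fiber A).
Proof.
move=> mA.
have -> : fiber A = `]0, +oo[ `&`
    \bigcup_n ((fun x : R => 3 ^ (n%:Z) * x) @^-1` A `|`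
                (fun x : R => 3 ^ (Negz n) * x) @^-1` A).
  apply/seteqP; split => x.
    move=> [x0 [[] n Ax]]; (split; first by rewrite /= in_itv/= x0);
      exists n => //; by [left|right].
  move=> [/=]; rewrite in_itv/= andbT => x0 [n _ [Ax|Ax]]; split => //.
    by exists n%:Z.
  by exists (Negz n).
apply: measurableI; first exact: measurable_itv.
apply: bigcup_measurable => n _; apply: measurableU; apply: measurable_preimage => //;
  exact: measurable_funM.
Qed.

Lemma fiber_mul3 A : mul_stable 3 (fiber A).
Proof.
move=> x x0; have n3 : 3 != 0 :> R by [].
split => -[_ [k Ak]]; split => //.
- by exists (k + 1); rewrite expfzDr// expr1z -mulrA.
- by rewrite mulr_gt0.
- by exists (k - 1); rewrite mulrA -[X in _ * X * _]expr1z -expfzDr// subrK.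
Qed.

Lemma exprz3_cases k : [\/ k = 0, 3 <= 3 ^ k :> R | 3 ^ k <= 3^-1 :> R].
Proof.
case: k => [[|n]|n]; [exact: Or31| |].
  apply: Or32; rewrite -exprnP exprS ler_peMr// exprn_ege1// ler1n.
  by [].
apply: Or33; rewrite NegzE -exprnN lef_pV2 ?posrE ?exprn_gt0//.
by rewrite exprS ler_peMr// exprn_ege1// ler1n.
Qed.

Lemma fiber_unique x M k : 0 < x -> M / 3 <= x < M -> M / 3 <= 3 ^ k * x < M ->
  k = 0.
Proof.
move=> x0 /andP[x1 x2] /andP[k1 k2]; case: (exprz3_cases k) => // h.
  have : 3 * x <= 3 ^ k * x by rewrite ler_pM2r.
  by move: (3 ^ k * x) k1 k2 => y *; exfalso; lra.
have : 3 ^ k * x <= 3^-1 * x by rewrite ler_pM2r.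
by move: (3 ^ k * x) k1 k2 => y *; exfalso; lra.
Qed.

(** The window [[M / 3, M[] is a fundamental domain for multiplication by 3, so below [M] the mass
    of the fiber is at most that of [A] plus a third of itself: this gives 3/2. The remaining 3
    comes from [mass_mul3_stable]. *)
Lemma sparse_fiber A M e : measurable A -> 0 < M ->
  A `<=` [set x | M / 3 <= x < M] -> mass A M <= e * M ->
  sparse (fiber A) (9 / 2 * e).
Proof.
move=> mA M0 AM Ae; have mF := measurable_fiber mA.
have F3 := @fiber_mul3 A.
have FM : mass (fiber A) M <= 3 / 2 * mass A M.
  have h1 : mass (fiber A) M = 3 * mass (fiber A) (M / 3).
    by rewrite -mass_mul// mulrC mulfVK.
  pose D : set R := fiber A `&` `]0, M / 3[.
  have mD : measurable D by exact: measurableI_itv.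
  have h2 : mass (fiber A) M <= mass (D `|` A) M.
    apply: le_mass => //; first exact: measurableU.
    move=> x [Fx]; rewrite /= in_itv/= => /andP[x0 xM].
    rewrite x0 xM; split => //.
    have [xM3|xM3] := ltP x (M / 3); [left|right].
      by split => //=; rewrite in_itv/= x0.
    case: Fx => _ [k Ak].
    have := AM _ Ak => /= kM.
    have k0 : k = 0 by apply: (fiber_unique x0) kM; rewrite xM3.
    by move: Ak; rewrite k0 expr0z mul1r.
  have h3 : mass D M <= mass (fiber A) (M / 3).
    by apply: le_mass => // x [[Fx xM] _]; split.
  have := massU M mD mA; lra.
exists (fiber A); split => // r r0.
apply: (le_trans (mass_mul3_stable mF F3 r0 M0)).
rewrite ler_pM2r// ler_pdivrMr//.
lra.
Qed.

End sparse.

(** * Large deviations of the number of odd steps *)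

Section deviations.
Context {R : realType}.
Implicit Types (x w a b rho : R) (c n L s : nat).

Lemma measurable_is_odd : measurable [set x : R | is_odd x].
Proof.
have E (m : int) : [set x : R | nearest_int x = m] =
    `]m%:~R - 2^-1, m%:~R + 2^-1]%classic.
  apply/seteqP; split => x /=; rewrite in_itv/=.
    by move=> /nearest_intP /andP[h1 h2]; apply/andP; split; lra.
  by move=> /andP[h1 h2]; apply/nearest_intP/andP; split; lra.
have -> : [set x : R | is_odd x] = \bigcup_n
    ([set x | nearest_int x = n.*2.+1 :> int] `|`
     [set x | nearest_int x = Negz n.*2]).
  apply/seteqP; split => x; rewrite /is_odd /=.
    case xn: (nearest_int x) => [n|n] nodd.
      by exists n./2 => //; left; rewrite /= xn; lia.
    by exists n./2 => //; right; rewrite /= xn; lia.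
  by move=> [n _ []/= ->]; lia.
by apply: bigcup_measurable => n _; rewrite !E; apply: measurableU;
  exact: measurable_itv.
Qed.

Lemma measurable_collatzR : measurable_fun [set: R] (@collatzR R).
Proof.
have mb : measurable_fun [set: R] (fun x : R => is_odd x).
  by apply: (measurable_fun_bool true); rewrite setTI; exact: measurable_is_odd.
have -> : @collatzR R = fun x => if is_odd x then 2^-1 * (3 * x) else 2^-1 * x.
  apply/funext => x; rewrite collatzRE.
  by case: (is_odd x); rewrite ?expr0 ?expr1 ?mul1r mulrC.
by apply: measurable_fun_ifT => //; do ?apply: measurable_funM.
Qed.

Lemma measurable_iter_collatzR n : measurable_fun [set: R] (iter n (@collatzR R)).
Proof.
elim: n => [|n IH]; first exact: measurable_id.
exact: measurableT_comp measurable_collatzR IH.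
Qed.

Lemma measurable_odd_steps n (P : set nat) :
  measurable [set x : R | P (odd_steps n x)].
Proof.
elim: n P => [|n IH] P.
  have [P0|P0] := pselect (P 0%N).
    rewrite (_ : [set _ | _] = setT)//.
    by apply/seteqP; split => x //= _; rewrite odd_steps0.
  rewrite (_ : [set _ | _] = set0)//.
  by apply/seteqP; split => x //=; rewrite odd_steps0.
have -> : [set x : R | P (odd_steps n.+1 x)] =
    ([set x | is_odd x] `&` collatzR @^-1` [set x | P (1 + odd_steps n x)%N])
    `|` (~` [set x | is_odd x] `&` collatzR @^-1` [set x | P (odd_steps n x)]).
  apply/seteqP; split => x /=; rewrite odd_stepsS.
    by case: (is_odd x) => Px; [left|right].
  by move=> [[->]//|[/negP/negbTE ->]].
apply: measurableU; apply: measurableI.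
- exact: measurable_is_odd.
- exact: measurable_preimage measurable_collatzR (IH (fun m => P (1 + m)%N)).
- by apply: measurableC; exact: measurable_is_odd.
- exact: measurable_preimage measurable_collatzR (IH P).
Qed.

(** Markov's inequality for [w ^+ odd_steps L x], whose sum over a progression is given by
    [odd_steps_gen]. *)
Lemma mass_odd_steps L w a c : odd c -> 0 < w -> 0 < a ->
  mass [set x : R | a <= w ^+ odd_steps L x] (c * 2 ^ L)%:R <=
  c%:R * ((1 + w) ^+ L / a).
Proof.
move=> oc w0 a0; apply: mass_progression.
  exact: (measurable_odd_steps L (fun m => a <= w ^+ m)).
move=> z; rewrite -(odd_steps_gen L w z oc) mulr_suml.
apply: ler_sum => k _; rewrite indicE; case: (boolP (_ \in _)) => [|_].
  by rewrite inE /= => h; rewrite ler_pdivlMr// mul1r.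
by rewrite divr_ge0// ?exprn_ge0// ltW.
Qed.

Lemma expR_le_quadratic x : x <= 2^-1 -> expR x <= 1 + x + 2 * x ^+ 2.
Proof.
move=> x2; have h : 0 < 1 - x by lra.
have h1 : expR x <= (1 - x)^-1.
  by rewrite -[x in expR x]opprK expRN lef_pV2 ?posrE ?expR_gt0// expR_ge1Dx.
apply: (le_trans h1); rewrite -[leLHS]mul1r ler_pdivrMr//.
nra.
Qed.

(** At [v = 0] the sum equals 2 and its derivative [a + b] is negative. *)
Lemma exists_expR_add_lt2 a b : a + b < 0 ->
  exists2 v, 0 < v & expR (a * v) + expR (b * v) < 2.
Proof.
move=> ab0; pose q := a ^+ 2 + b ^+ 2.
have q0 : 0 < q.
  have := sqr_ge0 (a - b); have : 0 < (a + b) * (a + b) by rewrite nmulr_rgt0.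
  by rewrite /q; nra.
(* This [v] minimises [2 + v * (a + b) + 2 * q * v ^+ 2], the upper bound given by
   [expR_le_quadratic]. *)
pose v := - (a + b) / (4 * q); have v0 : 0 < v.
  by rewrite divr_gt0 ?mulr_gt0//; lra.
have vq : v * (4 * q) = - (a + b) by rewrite mulfVK// gt_eqF// mulr_gt0.
have half t : t * - (a + b) <= 2 * q -> t * v <= 2^-1.
  by move=> h; rewrite mulrA ler_pdivrMr ?mulr_gt0//; lra.
exists v => //.
have h1 : a * v <= 2^-1.
  by apply: half; have := sqr_ge0 (a + b); have := sqr_ge0 b; rewrite /q; nra.
have h2 : b * v <= 2^-1.
  by apply: half; have := sqr_ge0 (a + b); have := sqr_ge0 a; rewrite /q; nra.
apply: (le_lt_trans (lerD (expR_le_quadratic h1) (expR_le_quadratic h2))).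
have -> : 1 + a * v + 2 * (a * v) ^+ 2 + (1 + b * v + 2 * (b * v) ^+ 2) =
  2 + v * (a + b) + v * (v * (4 * q)) / 2 by rewrite /q; field.
by rewrite vq; nra.
Qed.

(** Chernoff's bound, with [w] equal to 3 to the power [v]. The sign of [v] is left free: positive
    [v] handles the upper tail, negative [v] the lower one. *)
Lemma mass_deviation v rho L c : odd c ->
  mass [set x : R | rho * L%:R * ln 2 * v <= (odd_steps L x)%:R * ln 3 * v]
    (c * 2 ^ L)%:R <=
  ((expR (- (rho * ln 2) * v) + expR ((ln 3 - rho * ln 2) * v)) / 2) ^+ L
    * (c * 2 ^ L)%:R.
Proof.
move=> oc; pose w := expR (ln 3 * v); pose a := expR (rho * L%:R * ln 2 * v).
have := @mass_odd_steps L w a c oc (expR_gt0 _) (expR_gt0 _).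
have -> : [set x | a <= w ^+ odd_steps L x] =
    [set x : R | rho * L%:R * ln 2 * v <= (odd_steps L x)%:R * ln 3 * v].
  apply/seteqP; split => x; rewrite /= /a /w -expRM_natl ler_expR;
  by rewrite mulrA.
move/le_trans; apply.
have -> : a = expR (rho * ln 2 * v) ^+ L.
  by rewrite -expRM_natl /a; congr expR; ring.
rewrite -expr_div_n natrM natrX mulrCA ler_wpM2l// -exprMn.
rewrite mulfVK// le_eqVlt; apply/predU1P; left; congr (_ ^+ _).
rewrite mulrDl mul1r -expRN mulNr; congr (_ + _).
by rewrite /w -expRD; congr expR; ring.
Qed.

(** The exponents in [mass_deviation] add up to [v] times [ln 3 - 2 * rho * ln 2], which is negative
    for [v > 0], so some [v] makes the base less than 1, uniformly in [L] and [c]. *)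
Lemma mass_odd_steps_gt rho : log2 3 / 2 < rho -> exists theta : R,
  0 < theta < 1 /\ forall L s c, odd c -> rho * L%:R <= s%:R ->
  mass [set x : R | 2 ^+ s < 3 ^+ odd_steps L x :> R] (c * 2 ^ L)%:R <=
  theta ^+ L * (c * 2 ^ L)%:R.
Proof.
move=> hrho; have l2 : 0 < ln (2 : R) by rewrite ln_gt0// ltr1n.
have /exists_expR_add_lt2[v v0 hv] : - (rho * ln 2) + (ln 3 - rho * ln 2) < 0.
  move: hrho; rewrite /log2 ltr_pdivrMr// ltr_pdivrMr//.
  by lra.
exists ((expR (- (rho * ln 2) * v) + expR ((ln 3 - rho * ln 2) * v)) / 2); split.
  by rewrite divr_gt0 ?addr_gt0 ?expR_gt0//=; lra.
move=> L s c oc Ls; apply: le_trans (mass_deviation _ _ _ oc).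
apply: le_mass.
- exact: (measurable_odd_steps L (fun m => 2 ^+ s < 3 ^+ m :> R)).
- exact: (measurable_odd_steps L
    (fun m => rho * L%:R * ln 2 * v <= m%:R * ln 3 * v)).
apply: setSI => x /= h; rewrite ler_pM2r//.
have : ln (2 ^+ s) < ln (3 ^+ odd_steps L x) :> R.
  by rewrite ltr_ln ?posrE ?exprn_gt0.
rewrite !lnXn// -(mulr_natl (ln 2)) -(mulr_natl (ln 3)) => /ltW; apply: le_trans.
by rewrite ler_pM2r.
Qed.

(** The same argument with [- v] in place of [v]. *)
Lemma mass_odd_steps_lt rho : rho < log2 3 / 2 -> exists theta : R,
  0 < theta < 1 /\ forall L s c, odd c -> s%:R <= rho * L%:R ->
  mass [set x : R | 3 ^+ odd_steps L x < 2 ^+ s :> R] (c * 2 ^ L)%:R <=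
  theta ^+ L * (c * 2 ^ L)%:R.
Proof.
move=> hrho; have l2 : 0 < ln (2 : R) by rewrite ln_gt0// ltr1n.
have /exists_expR_add_lt2[v v0 hv] : rho * ln 2 + (rho * ln 2 - ln 3) < 0.
  move: hrho; rewrite /log2 ltr_pdivlMr// ltr_pdivlMr//.
  by lra.
exists ((expR (- (rho * ln 2) * - v) + expR ((ln 3 - rho * ln 2) * - v)) / 2).
split.
  rewrite divr_gt0 ?addr_gt0 ?expR_gt0//= ltr_pdivrMr// mul1r.
  by rewrite mulrNN mulrN -mulNr opprB.
move=> L s c oc Ls; apply: le_trans (mass_deviation _ _ _ oc).
apply: le_mass.
- exact: (measurable_odd_steps L (fun m => 3 ^+ m < 2 ^+ s :> R)).
- exact: (measurable_odd_steps L
    (fun m => rho * L%:R * ln 2 * - v <= m%:R * ln 3 * - v)).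
apply: setSI => x /= h; rewrite !mulrN lerN2 ler_pM2r//.
have : ln (3 ^+ odd_steps L x) < ln (2 ^+ s) :> R.
  by rewrite ltr_ln ?posrE ?exprn_gt0.
rewrite !lnXn// -(mulr_natl (ln 2)) -(mulr_natl (ln 3)) => /ltW/le_trans; apply.
by rewrite ler_pM2r.
Qed.

End deviations.

(** * Descent in blocks *)

Section descent.
Context {R : realType}.
Implicit Types (x y e rho theta : R) (k : int) (c n L s : nat).

Lemma iter_collatzR_fiber_le n x k k' : 0 < x -> k <= k' ->
  iter n collatzR (3 ^ k * x) <= iter n collatzR (3 ^ k' * x).
Proof.
move=> x0 kk'; have [j ->] : exists j : nat, k' = j%:Z + k.
  by exists `|k' - k|%N; lia.
rewrite expfzDr// -mulrA -exprnP.
by apply: iter_collatzR_le; rewrite mulr_gt0// exprz_gt0.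
Qed.

(** Distinct points of a fiber differ by a factor of at least 3. *)
Lemma expz3_mul_lt x k k' : 0 < x -> 3 ^ k * x < 3 * (3 ^ k' * x) -> k <= k'.
Proof.
move=> x0; rewrite mulrA ltr_pM2r// -[X in _ < X * _]expr1z -expfzDr//.
rewrite ltr_eXz2l ?ltr1n// => h; lia.
Qed.

(** Each fiber has a single representative in the window, so fibers with an exceptional
    representative are as rare as exceptional points, up to the factor 9/2. *)
Lemma sparse_fiber_deviation (P : set R) c L e : (0 < c)%N -> measurable P ->
  mass P (c * 2 ^ L)%:R <= e * (c * 2 ^ L)%:R ->
  sparse (fiber ([set y | (c * 2 ^ L)%:R / 3 <= y < (c * 2 ^ L)%:R] `&` P))
    (9 / 2 * e).
Proof.
move=> c0 mP Pe; set M : R := (c * 2 ^ L)%:R.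
have mI : measurable [set y : R | M / 3 <= y < M].
  rewrite (_ : [set _ | _] = `[M / 3, M[%classic); first exact: measurable_itv.
  by apply/seteqP; split => y /=; rewrite in_itv.
apply: (@sparse_fiber _ _ M); first exact: measurableI.
- by rewrite /M ltr0n muln_gt0 c0 expn_gt0.
- exact: subIsetl.
- apply: le_trans Pe; apply: le_mass => //; first exact: measurableI.
  by apply: setSI; exact: subIsetr.
Qed.

(** Inductive step of both descents: as [C * (1 - theta) = 9 / 2], the decrease of [C * theta ^+ l]
    when [l] passes from [m] to [L] pays for a new exceptional set of density
    [9 / 2 * theta ^+ L]. *)
Lemma geometric_step theta (C := 9 / 2 / (1 - theta)) e m L :
  0 < theta < 1 -> (m < L)%N ->
  9 / 2 * theta ^+ L + C * (e - theta ^+ m) <= C * (e - theta ^+ L).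
Proof.
move=> /andP[t0 t1]; case: L => // L mL.
have t1' : 0 < 1 - theta by lra.
have C0 : 0 < C by rewrite divr_gt0.
have h1 : theta ^+ L <= theta ^+ m by rewrite ler_wiXn2l// ltW.
have h2 : theta ^+ L.+1 <= theta ^+ L by rewrite ler_wiXn2l// ltW.
have CE : C * (theta ^+ L - theta ^+ L.+1) = 9 / 2 * theta ^+ L.
  by rewrite /C exprS; field; rewrite gt_eqF.
have h3 : C * theta ^+ L <= C * theta ^+ m by rewrite ler_pM2l.
lra.
Qed.

(** After [L] steps the orbit lies in the fiber of [x / 2 ^+ L] whatever the parities; these only
    affect the exponent of 3. *)
Lemma iter_collatzR_splitE n L x k :
  iter (n + L) collatzR (3 ^ k * x) =
  iter n collatzR (3 ^ ((odd_steps L (3 ^ k * x))%:Z + k) * (x / 2 ^+ L)).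
Proof.
rewrite iterD (iter_collatzRE L) expfzDr// -exprnP.
by congr (iter n collatzR _); rewrite !mulrA.
Qed.

(* With [s] just above [rho * L], one block of [L] steps sends all points of a
   fiber below [2 ^ L] under [2 ^ s], unless the largest of them is exceptional;
   monotonicity along fibers is what allows to restart from the largest point. *)
Lemma sparse_descent rho A : log2 3 / 2 < rho < 1 -> 1 < A * (1 - rho) ->
  exists theta C, [/\ 0 < theta < 1, 0 < C & exists L1 : nat,
    forall L0 L, (L1 <= L0)%N -> exists2 n, n%:R <= A * L%:R &
      sparse [set x : R | 0 < x /\ exists k,
        3 ^ k * x < 2 ^+ L /\ 2 ^+ L0 <= iter n collatzR (3 ^ k * x)]
        (C * theta ^+ L0)].
Proof.
move=> /andP[hrho rho1] Arho.
have [theta [t01 Ht]] := mass_odd_steps_gt hrho.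
have /andP[t0 t1] := t01.
have rho1' : 0 < 1 - rho by lra.
have A0 : 0 < A by rewrite -(pmulr_lgt0 _ rho1') (lt_trans ltr01).
have rho0 : 0 < rho.
  by apply: lt_trans hrho; rewrite !divr_gt0// ln_gt0// ltr1n.
pose C := 9 / 2 / (1 - theta); have C0 : 0 < C by rewrite !divr_gt0//; lra.
exists theta, C; split => //.
have Arho' : 0 < A * (1 - rho) - 1 by lra.
(* For [L] beyond this bound, rounding [rho * L] up to [s] still leaves [L + A * s <= A * L], so the
   time budget is inherited. *)
exists (Num.truncn (A / (A * (1 - rho) - 1))).+1 => L0 L L1L0.
pose V n L := [set x : R | 0 < x /\ exists k,
  3 ^ k * x < 2 ^+ L /\ 2 ^+ L0 <= iter n collatzR (3 ^ k * x)].
(* The strengthened bound vanishes for [L <= L0], where the set is empty, and telescopes along the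
   induction on [L]. *)
suff [n nL nV] : exists2 n, n%:R <= A * L%:R &
    sparse (V n L) (C * (theta ^+ L0 - theta ^+ maxn L0 L)).
  exists n => //; apply: sparse_sub nV => //; rewrite ler_pM2l// lerBlDr lerDl.
  by rewrite exprn_ge0// ltW.
have [m] := ubnP L; elim: m L => // m IH L Lm.
have [LL0|L0L] := leqP L L0.
  exists 0%N; first by rewrite mulr_ge0// ltW.
  rewrite subrr mulr0.
  rewrite (_ : V 0%N L = set0); first exact: sparse0.
  rewrite -subset0 => x [x0 [k [/= h1 h2]]].
  move: (le_lt_trans h2 h1); rewrite ltNge => /negP; apply.
  by rewrite ler_weXn2l// ler1n.
pose s := (Num.truncn (rho * L%:R)).+1.
have LR0 : 0 < L%:R :> R by rewrite ltr0n (leq_ltn_trans _ L0L).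
have /truncn_itv/andP[s1 s2] : 0 <= rho * L%:R by rewrite mulr_ge0// ltW.
have As : L%:R + A * s%:R <= A * L%:R.
  have : A / (A * (1 - rho) - 1) < L%:R.
    have /truncn_itv/andP[_ h] : 0 <= A / (A * (1 - rho) - 1).
      by rewrite divr_ge0// ltW.
    by apply: (lt_le_trans h); rewrite ler_nat; exact: ltnW (leq_ltn_trans L1L0 L0L).
  rewrite ltr_pdivrMr// => h.
  have : A * s%:R <= A * (rho * L%:R + 1).
    by rewrite ler_pM2l// /s -addn1 natrD lerD2r.
  by move: h; lra.
have sL : (s < L)%N by rewrite -(ltr_nat R) -(ltr_pM2l A0); lra.
have [n nA Vn] := IH s (leq_trans sL Lm).
exists (n + L)%N; first by rewrite natrD; lra.
have L0sL : (maxn L0 s < L)%N by rewrite gtn_max L0L.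
apply: sparse_sub (geometric_step (theta ^+ L0) t01 L0sL) _; last first.
  have o1 : odd 1 by [].
  have := Ht L s 1%N o1 (ltW s2).
  move=> /(sparse_fiber_deviation (ltn0Sn _) (measurable_odd_steps L
    (fun m => 2 ^+ s < 3 ^+ m :> R))) h.
  have p2 : 0 < 2 ^+ L :> R by rewrite exprn_gt0.
  exact: sparseU h (sparse_scale p2 Vn).
move=> x [x0 [k [kL kn]]].
have p2 : 0 < 2 ^+ L :> R by rewrite exprn_gt0.
(* The largest point of the fiber below [2 ^+ L]. *)
have [k' /andP[k'1 k'2]] := fiber_point x0 p2.
have kk' : k <= k'.
  apply: (expz3_mul_lt x0); apply: (lt_le_trans kL).
  by rewrite -ler_pdivrMl// mulrC.
have := iter_collatzR_fiber_le (n + L) x0 kk'; move/(le_trans kn) => k'n.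
set y := 3 ^ k' * x in k'1 k'2 k'n.
have [yS|yS] := ltP (2 ^+ s : R) (3 ^+ odd_steps L y).
  left; split => //; exists k'; split => //=.
  by rewrite mul1n natrX k'1.
right; split; first by rewrite divr_gt0.
exists ((odd_steps L y)%:Z + k'); rewrite -iter_collatzR_splitE; split => //.
rewrite expfzDr// -exprnP.
have -> : 3 ^+ odd_steps L y * 3 ^ k' * (x / 2 ^+ L) =
    3 ^+ odd_steps L y * y / 2 ^+ L by rewrite /y !mulrA.
rewrite ltr_pdivrMr//.
apply: (@lt_le_trans _ _ (3 ^+ odd_steps L y * 2 ^+ L)).
  by rewrite ltr_pM2l// exprn_gt0.
by rewrite ler_pM2r.
Qed.

(** Counterpart of [sparse_descent] that follows the smallest point of a fiber at or above
    [c * 2 ^ L]. The odd factor [c] allows the final height to exceed a given [K]. *)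
Lemma sparse_fast_descent rho A c : 0 < rho < 1 -> rho < log2 3 / 2 -> 0 <= A ->
  A * (1 - rho) < 1 -> odd c ->
  exists theta C, [/\ 0 < theta < 1, 0 < C & exists L1 : nat,
    forall L0 L, (L1 <= L0)%N ->
      sparse [set x : R | 0 < x /\ exists k, (c * 2 ^ L)%:R <= 3 ^ k * x /\
        exists n, n%:R <= A * (L%:R - L0%:R) /\
          iter n collatzR (3 ^ k * x) < c%:R]
        (C * theta ^+ L0)].
Proof.
move=> /andP[rho0 rho1] hrho A0 Arho oc.
have [theta [t01 Ht]] := mass_odd_steps_lt hrho.
have /andP[t0 t1] := t01.
have c0 : (0 < c)%N by case: c oc.
have c0R : 0 < c%:R :> R by rewrite ltr0n.
pose C := 9 / 2 / (1 - theta); have C0 : 0 < C by rewrite !divr_gt0//; lra.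
exists theta, C; split => //.
have Arho' : 0 < 1 - A * (1 - rho) by lra.
(* Here [rho * L] is rounded down to [s], and large [L] ensures [A * (L - s) <= L]: a block of [L]
   steps uses up its share of the time. *)
exists (Num.truncn (A / (1 - A * (1 - rho)))).+1 => L0 L L1L0.
pose W L := [set x : R | 0 < x /\ exists k, (c * 2 ^ L)%:R <= 3 ^ k * x /\
  exists n, n%:R <= A * (L%:R - L0%:R) /\ iter n collatzR (3 ^ k * x) < c%:R].
suff WL : sparse (W L) (C * (theta ^+ L0 - theta ^+ maxn L0 L)).
  apply: sparse_sub WL => //; rewrite ler_pM2l// lerBlDr lerDl.
  by rewrite exprn_ge0// ltW.
have [m] := ubnP L; elim: m L => // m IH L Lm.
have [LL0|L0L] := leqP L L0.
  rewrite subrr mulr0.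
  rewrite (_ : W L = set0); first exact: sparse0.
  rewrite -subset0 => x [x0 [k [h1 [n [nL h2]]]]].
  have n0 : n = 0%N.
    apply/eqP; rewrite -leqn0 -(ler_nat R); apply: (le_trans nL).
    by rewrite mulr_ge0_le0// subr_le0 ler_nat.
  move: h2; rewrite n0 /= ltNge => /negP; apply; apply: le_trans h1.
  by rewrite ler_nat leq_pmulr// expn_gt0.
pose s := Num.truncn (rho * L%:R).
have LR0 : 0 < L%:R :> R by rewrite ltr0n (leq_ltn_trans _ L0L).
have /truncn_itv/andP[s1 s2] : 0 <= rho * L%:R by rewrite mulr_ge0// ltW.
have As : A * (L%:R - s%:R) <= L%:R.
  have : A / (1 - A * (1 - rho)) < L%:R.
    have /truncn_itv/andP[_ h] : 0 <= A / (1 - A * (1 - rho)).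
      by rewrite divr_ge0// ltW.
    by apply: (lt_le_trans h); rewrite ler_nat; exact: ltnW (leq_ltn_trans L1L0 L0L).
  rewrite ltr_pdivrMr// => h.
  have : A * (rho * L%:R - 1) <= A * s%:R.
    rewrite ler_wpM2l// lerBlDr; apply: ltW.
    by move: s2; rewrite -addn1 natrD.
  by move: h; lra.
have sL : (s < L)%N.
  by rewrite -(ltr_nat R); apply: (le_lt_trans s1); rewrite gtr_pMl.
have Ws := IH s (leq_trans sL Lm).
have L0sL : (maxn L0 s < L)%N by rewrite gtn_max L0L.
apply: sparse_sub (geometric_step (theta ^+ L0) t01 L0sL) _; last first.
  (* The smallest point at or above [c * 2 ^ L] lies below [3 * c * 2 ^ L], so parities are counted
     on a progression of odd difference [3 * c]. *)
  have o3 : odd (3 * c) by rewrite oddM.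
  have c3 : (0 < 3 * c)%N by rewrite muln_gt0.
  have := Ht L s _ o3 s1.
  move=> /(sparse_fiber_deviation c3 (measurable_odd_steps L
    (fun m => 3 ^+ m < 2 ^+ s :> R))) h.
  have p2 : 0 < 2 ^+ L :> R by rewrite exprn_gt0.
  exact: sparseU h (sparse_scale p2 Ws).
move=> x [x0 [k [kL [n [nL kn]]]]].
have p2 : 0 < 2 ^+ L :> R by rewrite exprn_gt0.
have M0 : 0 < (3 * c * 2 ^ L)%:R :> R.
  by rewrite ltr0n !muln_gt0 c0 expn_gt0.
have [k' /andP[k'1 k'2]] := fiber_point x0 M0.
have k'3 : (c * 2 ^ L)%:R <= 3 ^ k' * x.
  by move: k'1; rewrite -mulnA natrM mulrAC divff ?mul1r// pnatr_eq0.
have kk' : k' <= k.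
  apply: (expz3_mul_lt x0); apply: (lt_le_trans k'2).
  by rewrite -mulnA natrM ler_pM2l.
have := iter_collatzR_fiber_le n x0 kk'; move/le_lt_trans => /(_ _ kn) k'n.
set y := 3 ^ k' * x in k'1 k'2 k'3 k'n.
have y0 : 0 < y by rewrite mulr_gt0// exprz_gt0.
(* A step at most halves a point, so coming below [c] from [c * 2 ^ L] takes at least [L] steps. *)
have Ln : (L <= n)%N.
  rewrite leqNgt; apply/negP => nL'; move: k'n; rewrite ltNge => /negP; apply.
  apply: le_trans (iter_collatzR_ge n y0).
  rewrite ler_pdivlMr ?exprn_gt0//; apply: le_trans k'3.
  by rewrite natrM natrX ler_pM2l// ler_weXn2l ?ler1n// ltnW.
have [yS|yS] := ltP (3 ^+ odd_steps L y) (2 ^+ s : R).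
  by left; split => //; exists k'; split => //=; rewrite k'1.
right; split; first by rewrite divr_gt0.
exists ((odd_steps L y)%:Z + k'); split.
  rewrite expfzDr// -exprnP.
  have -> : 3 ^+ odd_steps L y * 3 ^ k' * (x / 2 ^+ L) =
      3 ^+ odd_steps L y * y / 2 ^+ L by rewrite /y !mulrA.
  rewrite ler_pdivlMr//.
  apply: (@le_trans _ _ (3 ^+ odd_steps L y * (c * 2 ^ L)%:R)).
    rewrite !natrM !natrX mulrCA -mulrA ler_pM2l// ler_pM2r//.
  by rewrite ler_pM2l// exprn_gt0.
exists (n - L)%N; rewrite -iter_collatzR_splitE subnK//; split => //.
rewrite natrB//; move: nL As; lra.
Qed.

End descent.

(** * Zero-one law *)

Section zero_one.
Context {R : realType}.
Implicit Types (x y e g h r s K M : R) (A : set R) (k : int).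
Local Notation mu := (@lebesgue_measure R).

Lemma pow2_neq_pow3 (m n : nat) : (0 < n)%N -> 2 ^+ n != 3 ^+ m :> R.
Proof.
move=> n0; rewrite -!natrX eqr_nat; apply/eqP => /(congr1 odd).
by rewrite !oddX /= orbT gtn_eqF.
Qed.

Definition subgroup_of_2_3 (G : set R) := [/\ G 2, G 3,
  forall g h, G g -> G h -> G (g * h) & forall g, G g -> G g^-1].

Lemma subgroup_exprz (G : set R) g k : subgroup_of_2_3 G -> G g -> G (g ^ k).
Proof.
move=> [G2 _ GM GV] Gg.
have Gn n : G (g ^+ n).
  elim: n => [|n IH]; last by rewrite exprS; exact: GM.
  by rewrite expr0 -(@divff _ (2 : R))//; apply: GM => //; exact: GV.
by case: k => n; [exact: Gn|rewrite NegzE -exprnN; exact/GV].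
Qed.

(* Otherwise 2 and 3 would both be powers of h. *)
Lemma subgroup_sqrt (G : set R) h : subgroup_of_2_3 G -> G h -> 1 < h ->
  exists h', [/\ G h', 1 < h' & h' ^+ 2 <= h].
Proof.
move=> GG Gh h1; have [G2 G3 GM GV] := GG; have h0 : 0 < h by exact: lt_trans h1.
(* Division of [g] by powers of [h] leaves [r] in []1, h]]. If [r < h], one of [r] and [h / r] has
   square at most [h], as their product is [h]. *)
have split_power g : G g -> 1 < g ->
    (exists h', [/\ G h', 1 < h' & h' ^+ 2 <= h]) \/ exists k, g = h ^ k.
  move=> Gg g1; have g0 : 0 < g by exact: lt_trans g1.
  have [k] := exprz_between h1 ltr01 g0; rewrite mulr1 => /andP[k1 k2].
  have hk0 : 0 < h ^ k by rewrite exprz_gt0.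
  pose r := g / h ^ k; have r1 : 1 < r by rewrite ltr_pdivlMr// mul1r.
  have r0 : 0 < r by exact: lt_trans r1.
  have Gr : G r by apply: GM => //; apply: GV; exact: subgroup_exprz.
  have : r <= h by rewrite ler_pdivrMr// mulrC -ler_pdivrMr.
  rewrite le_eqVlt => /predU1P[rh|rh].
    right; exists (k + 1); rewrite expfzDr ?gt_eqF// expr1z -[X in _ * X]rh /r.
    by rewrite mulrC mulfVK// gt_eqF.
  left; have [hr|hr] := leP (r ^+ 2) h; first by exists r.
  exists (h / r); split; first by apply: GM => //; exact: GV.
    by rewrite ltr_pdivlMr// mul1r.
  rewrite expr_div_n ler_pdivrMr ?exprn_gt0// expr2.
  by rewrite ler_pM2l// ltW.
have [//|[a ha]] := split_power 2 G2 (ltr1n _ 2).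
have [//|[b hb]] := split_power 3 G3 (ltr1n _ 3).
have a0 : 0 < a by rewrite -(ltr_eXz2l h1) expr0z -ha ltr1n.
have b0 : 0 < b by rewrite -(ltr_eXz2l h1) expr0z -hb ltr1n.
have : (2 : R) ^ b = 3 ^ a by rewrite ha hb !exprz_exp mulrC.
case: a b a0 b0 {ha hb} => [a|//] [b|//] a0 b0 /eqP.
by rewrite -!exprnP (negbTE (pow2_neq_pow3 _ _)).
Qed.

(** Iterating [subgroup_sqrt] from 2 gives [h ^+ (2 ^ n) <= 2]; once [2 ^ n > e^-1], Bernoulli's
    inequality forces [h < 1 + e]. *)
Lemma subgroup_near1 (G : set R) e : subgroup_of_2_3 G -> 0 < e ->
  exists h, [/\ G h, 1 < h & h < 1 + e].
Proof.
move=> GG e0; have [G2 _ _ _] := GG.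
have H n : exists h, [/\ G h, 1 < h & h ^+ (2 ^ n) <= 2].
  elim: n => [|n [h [Gh h1 hn]]]; first by exists 2; rewrite expn0 expr1 ltr1n.
  have [h' [Gh' h'1 h'h]] := subgroup_sqrt GG Gh h1.
  exists h'; split => //; apply: le_trans hn.
  by rewrite expnS exprM lerXn2r// nnegrE ?exprn_ge0// ltW// (lt_trans ltr01).
pose n := Num.truncn (e^-1).
have [h [Gh h1 hn]] := H n.
exists h; split => //; rewrite ltNge; apply/negP => eh.
have : 2 < (1 + e) ^+ (2 ^ n).
  have b1 m : 1 + m%:R * e <= (1 + e) ^+ m.
    elim: m => [|m IH]; first by rewrite mul0r addr0 expr0.
    have m0 : 0 <= m%:R :> R by [].
    rewrite exprS -addn1 natrD; nra.
  apply: lt_le_trans (b1 _).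
  have /truncn_itv/andP[_ ne] : 0 <= e^-1 by rewrite invr_ge0 ltW.
  have : 1 < (2 ^ n)%:R * e.
    rewrite -ltr_pdivrMr// mul1r (lt_le_trans ne)// ler_nat.
    exact: ltn_expl.
  lra.
rewrite ltNge => /negP; apply; apply: le_trans hn.
by rewrite lerXn2r// nnegrE; lra.
Qed.

(** The factors by which the mass scales exactly form a group containing 2 and 3, hence elements
    close to 1. Powers of such an [h] carry any [t] to within a factor [h] of any [s]. *)
Lemma mass_linear A r : measurable A -> mul_stable 2 A -> mul_stable 3 A ->
  0 < r -> mass A r = mass A 1 * r.
Proof.
move=> mA A2 A3 r0.
pose G := [set g | 0 < g /\ forall t, mass A (g * t) = g * mass A t].
have G2 : G 2 by split => // t; exact: mass_mul.
have G3 : G 3 by split => // t; exact: mass_mul.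
have GM g h : G g -> G h -> G (g * h).
  move=> [g0 Gg] [h0 Gh]; split; first exact: mulr_gt0.
  by move=> t; rewrite -!mulrA Gg Gh.
have GV g : G g -> G g^-1.
  move=> [g0 Gg]; split; first by rewrite invr_gt0.
  have gn0 : g != 0 by rewrite gt_eqF.
  by move=> t; apply: (mulfI gn0); rewrite -Gg !mulrA divff// !mul1r.
have GG : subgroup_of_2_3 G by [].
have key s t : 0 < s -> 0 < t -> mass A s / s <= mass A t / t.
  move=> s0 t0; apply/ler_addgt0Pr => e e0.
  pose c := mass A t / t; have c0 : 0 <= c by rewrite divr_ge0 ?mass_ge0// ltW.
  (* With [h - 1] below this value, the error [c * (h - 1)] is at most [e]. *)
  have d0 : 0 < e / (c + 1) by rewrite divr_gt0//; lra.
  have [h [Gh h1 he]] := subgroup_near1 GG d0.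
  have h0 : 0 < h by exact: lt_trans h1.
  have hs0 : 0 < s * h by rewrite mulr_gt0.
  have [k /andP[k1 k2]] := exprz_between h1 t0 hs0.
  have [hk0 Ghk] := subgroup_exprz k GG Gh.
  rewrite mulfK ?gt_eqF// in k1.
  have h2 : mass A s <= h ^ k * mass A t.
    rewrite -Ghk; apply: le_mass => // x [Ax]; rewrite /= !in_itv/= => /andP[-> xs].
    by split => //; exact: lt_le_trans k1.
  rewrite ler_pdivrMr//; apply: (le_trans h2).
  have -> : mass A t = c * t by rewrite mulfVK// gt_eqF.
  rewrite mulrCA; apply: (@le_trans _ _ (c * (s * h))).
    by rewrite ler_wpM2l// ltW.
  rewrite mulrA mulrAC ler_pM2r// mulfK ?gt_eqF//.
  have : (h - 1) * (c + 1) <= e by rewrite -ler_pdivlMr; lra.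
    lra.
have h1 := key r 1 r0 ltr01; have h2 := key 1 r ltr01 r0.
rewrite divr1 in h1 h2; apply/eqP; rewrite eq_le.
by rewrite -ler_pdivrMr// h1 -ler_pdivlMr.
Qed.

(* By linearity of the mass, the density of A at each point is mass A 1; it must
   be 1 at almost every point of A. *)
Lemma mass_mul23_stable A r : measurable A -> mul_stable 2 A -> mul_stable 3 A ->
  mass A 1 < 1 -> mass A r = 0.
Proof.
move=> mA A2 A3 p1; set p := mass A 1 in p1.
have p0 : 0 <= p by exact: mass_ge0.
have [N [mN N0 AN]] := lebesgue_density mA.
have AN0 : A `&` `]0, +oo[ `<=` N.
  move=> x [Ax]; rewrite /= in_itv/= andbT => x0; apply: AN => /= h.
  have ballE t : 0 < t -> ball x t = `]x - t, x + t[%classic.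
    move=> t0; rewrite -ball_normE /ball_ set_itvoo.
    by under eq_set => ? do rewrite ltr_distlC.
  have : ((\1_A x)%:E <= p%:E)%E.
    apply: cvge_to_le h _; near=> t.
    have t0 : 0 < t by [].
    have tx : t < x by near: t; exact: nbhs_right_lt.
    have mball : measurable (A `&` ball x t).
      by apply: measurableI => //; exact: measurable_ball.
    rewrite (lebesgue_measure_ball _ (ltW t0)) inver mulrn_eq0/= gt_eqF//.
    rewrite lee_pdivrMr ?pmulrn_lgt0// -EFinM.
    have disj : A `&` `]0, x - t[ `&` (A `&` ball x t) = set0.
      rewrite ballE// -subset0 => y [] [_ ] /=; rewrite in_itv/= => /andP[_ y1] [_].
      by rewrite /= in_itv/= => /andP[y2 _]; move: (lt_trans y1 y2); rewrite ltxx.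
    (* The ball lies between two initial segments, so by linearity [A] has mass at most
       [p * (x + t) - p * (x - t) = 2 * p * t] in it. *)
    have hU : (mu (A `&` `]0%R, (x - t)%R[) + mu (A `&` ball x t) <=
               mu (A `&` `]0%R, (x + t)%R[))%E.
      rewrite -measureU//; last exact: measurableI_itv.
      apply: le_measure; rewrite ?inE.
      - by apply: measurableU => //; exact: measurableI_itv.
      - exact: measurableI_itv.
      - rewrite ballE// => y [] [Ay]; rewrite /= !in_itv/= => /andP[y1 y2];
          split => //=; apply/andP; split; lra.
    move: hU; rewrite -!massE//.
    rewrite (@mass_linear A (x - t))//; last by lra.
    rewrite (@mass_linear A (x + t))//; last by lra.
    rewrite -/p -leeBrDl// -EFinB => /le_trans; apply.
    by rewrite lee_fin -mulrBr ler_wpM2l// mulr2n; lra.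
  by rewrite indicE mem_set// lee_fin leNgt p1.
apply/eqP; rewrite eq_le mass_ge0 andbT -lee_fin massE//.
apply: (@le_trans _ _ (mu N)); last by rewrite N0.
apply: le_measure; rewrite ?inE//; first exact: measurableI_itv.
apply: subset_trans AN0; apply: setIS => x /=.
by rewrite !in_itv/= => /andP[->].
Unshelve. all: by end_near.
Qed.

Definition never_below K : set R := [set y | forall n, K < iter n collatzR y].

Lemma measurable_collatzR_gt K n : measurable [set y : R | K < iter n collatzR y].
Proof.
rewrite (_ : [set _ | _] = iter n collatzR @^-1` `]K, +oo[).
  by apply: measurable_preimage (measurable_iter_collatzR n) _; exact: measurable_itv.
by apply/seteqP; split => y; rewrite /= in_itv/= andbT.
Qed.

Lemma measurable_never_below K : measurable (never_below K).
Proof.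
rewrite (_ : never_below K = \bigcap_n [set y | K < iter n collatzR y]).
  by apply: bigcapT_measurable => n; exact: measurable_collatzR_gt.
by apply/seteqP; split => [y h n _|y h n]; exact: h.
Qed.

(** The map sends the fiber of [2 * x] to that of [x]. Conversely, the image of [3 ^ k * (2 * x)] is
    at least [3 ^ k * x], so it stays above [K] by monotonicity along the fiber. *)
Lemma fiber_mul2 K : 0 < K -> mul_stable 2 (fiber (never_below K)).
Proof.
move=> K0 x x0; have n3 : 3 != 0 :> R by [].
split => -[_ [k Nk]]; split => //.
- exists ((is_odd (3 ^ k * (2 * x))%R : nat)%:Z + k) => n.
  have := Nk n.+1; rewrite iterSr collatzRE; set b := is_odd _.
  rewrite (_ : 3 ^+ b * (3 ^ k * (2 * x)) / 2 = 3 ^ (b%:Z + k) * x)//.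
  by rewrite expfzDr// -exprnP; field.
- by rewrite mulr_gt0.
- exists k => -[|n].
    have := Nk 0%N; rewrite /= => /lt_le_trans; apply.
    by rewrite mulrCA ler_peMl ?ler1n// mulr_ge0 ?ltW// exprz_gt0.
  rewrite iterSr collatzRE.
  set b := is_odd _.
  have := Nk n => /lt_le_trans; apply.
  rewrite (_ : 3 ^+ b * (3 ^ k * (2 * x)) / 2 = 3 ^ (b%:Z + k) * x).
    apply: iter_collatzR_fiber_le => //; lia.
  by rewrite expfzDr// -exprnP; field.
Qed.

Lemma log2_3_lt2 : log2 3 < 2 :> R.
Proof.
have l2 : 0 < ln (2 : R) by rewrite ln_gt0// ltr1n.
rewrite /log2 ltr_pdivrMr//.
have -> : 2 * ln 2 = ln (2 ^+ 2) :> R by rewrite lnXn// mulr_natl.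
by rewrite ltr_ln ?posrE ?exprn_gt0// -natrX ltr_nat.
Qed.

Lemma geometric_small (theta C e : R) : 0 < theta < 1 -> 0 < C -> 0 < e ->
  exists N : nat, forall n : nat, (N <= n)%N -> C * theta ^+ n <= e.
Proof.
move=> /andP[t0 t1] C0 e0.
have /cvgrPdist_le /(_ _ (divr_gt0 e0 C0)) [N _ hN] : theta ^+ n @[n --> \oo] --> 0.
  by apply: cvg_expr; rewrite gtr0_norm.
exists N => n Nn; have := hN n Nn.
by rewrite /= sub0r normrN gtr0_norm ?exprn_gt0// ler_pdivlMr// mulrC.
Qed.

Lemma mass_bigcup_le (F : (set R)^nat) r e : (forall n, measurable (F n)) ->
  nondecreasing_seq F -> (forall n, mass (F n) r <= e) ->
  mass (\bigcup_n F n) r <= e.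
Proof.
move=> mF ndF Fe; have mU : measurable (\bigcup_n F n) by exact: bigcupT_measurable.
rewrite -lee_fin massE// setI_bigcupl.
have mFr n : measurable (F n `&` `]0, r[) by exact: measurableI_itv.
have mUr : measurable (\bigcup_n (F n `&` `]0, r[)).
  exact: bigcupT_measurable.
apply: cvge_to_le (nondecreasing_cvg_mu (mu := mu) mFr mUr _) _.
  move=> m n mn; apply/subsetPset; apply: setSI.
  by have /subsetPset := ndF _ _ mn.
by apply: nearW; move=> n /=; rewrite -massE// lee_fin.
Qed.

(** Points below [2 ^+ L] that never come below the threshold are exceptional for [sparse_descent],
    with a density bound uniform in [L]. In the increasing limit the mass on []0, 1[] is at most
    1/2, and the zero-one law applies. *)
Lemma exists_never_below_null : exists L0 : nat,
  forall r, mass (fiber (never_below (2 ^+ L0))) r = 0.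
Proof.
have h2 := log2_3_lt2; pose rho : R := (log2 3 / 2 + 1) / 2.
have hrho : log2 3 / 2 < rho < 1 by apply/andP; split; rewrite /rho; lra.
have rho1 : 0 < 1 - rho by lra.
have Arho : 1 < 2 / (1 - rho) * (1 - rho) by rewrite mulfVK ?gt_eqF// ltr1n.
have [theta [C [t01 C0 [L1 H]]]] := sparse_descent hrho Arho.
have half0 : 0 < 2^-1 :> R by rewrite invr_gt0.
have [N hN] := geometric_small t01 C0 half0.
exists (maxn L1 N) => r; set L0 := maxn L1 N.
pose K : R := 2 ^+ L0; have K0 : 0 < K by rewrite exprn_gt0.
pose F L := never_below K `&` `]-oo, 2 ^+ L[.
have mF L : measurable (F L).
  by apply: measurableI; [exact: measurable_never_below|exact: measurable_itv].
have mB := measurable_fiber (measurable_never_below K).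
apply: mass_mul23_stable => //; [exact: fiber_mul2|exact: fiber_mul3|].
have -> : fiber (never_below K) = \bigcup_L fiber (F L).
  apply/seteqP; split => [x [x0 [k Nk]]|x [L _ [x0 [k [Nk _]]]]]; last first.
    by split => //; exists k.
  exists (Num.truncn (3 ^ k * x)).+1 => //; split => //; exists k; split => //=.
  have /truncn_itv/andP[_ h] : 0 <= 3 ^ k * x by rewrite mulr_ge0 ?ltW ?exprz_gt0.
  rewrite in_itv/= (lt_le_trans h)// -natrX ler_nat ltnW//.
  exact: ltn_expl.
apply: (@le_lt_trans _ _ 2^-1); last by lra.
apply: mass_bigcup_le => [L||L]; first exact: measurable_fiber.
  move=> m n mn; apply/subsetPset => x [x0 [k [Nk]]]; rewrite /= in_itv/= => xm.
  split => //; exists k; split => //; rewrite /= in_itv/= (lt_le_trans xm)//.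
  by rewrite ler_weXn2l// ler1n.
have [n _ [B [mB' VB hB]]] := H L0 L (leq_maxl _ _).
apply: le_trans (_ : mass B 1 <= _); last first.
  rewrite (le_trans (hB 1 ltr01))// mulr1; apply: hN; exact: leq_maxr.
apply: le_mass => //; first exact: measurable_fiber.
apply: setSI => x [x0 [k [Nk]]]; rewrite /= in_itv/= => xm.
by apply: VB; split => //; exists k; split => //; exact/ltW/Nk.
Qed.

(** As [T] grows these sets decrease to a null set. Continuity from above makes one of them small on
    []0, 1[], and stability under 3 extends the bound to all scales at the cost of a factor 3. *)
Lemma sparse_late K M e : 0 < K -> 0 < M -> 0 < e ->
  (forall r, mass (fiber (never_below K)) r = 0) ->
  exists T : nat, sparse (fiber [set y | y < M /\
    forall n, (n <= T)%N -> K < iter n collatzR y]) e.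
Proof.
move=> K0 M0 e0 B0.
pose F T := [set y : R | y < M /\ forall n, (n <= T)%N -> K < iter n collatzR y].
have mF T : measurable (F T).
  rewrite (_ : F T = `]-oo, M[ `&`
      \bigcap_(n in `I_T.+1) [set y | K < iter n collatzR y]).
    apply: measurableI; first exact: measurable_itv.
    by apply: fin_bigcap_measurable => // n _; exact: measurable_collatzR_gt.
  by apply/seteqP; split => y; rewrite /F /= in_itv/= => -[yM yn].
have mZ T := measurable_fiber (mF T).
pose Z T := fiber (F T) `&` `]0, 1[.
have mZ1 T : measurable (Z T) by exact: measurableI_itv.
have mcap : measurable (\bigcap_T Z T) by exact: bigcapT_measurable.
(* The surviving point may vary with [T], but the largest point of the fiber below [M] dominates
   them all and so survives for every [T]. *)
have Zcap : \bigcap_T Z T `<=` fiber (never_below K) `&` `]0, 1[.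
  move=> x Zx; have [[x0 _] x1] := Zx 0%N I.
  split => //; split => //; have [k /andP[k1 k2]] := fiber_point x0 M0.
  exists k => n; have [[_ [j [jM jn]]] _] := Zx n I.
  apply: (lt_le_trans (jn n (leqnn n))); apply: iter_collatzR_fiber_le => //.
  apply: (expz3_mul_lt x0); apply: (lt_le_trans jM).
  by rewrite -ler_pdivrMl// mulrC.
have mB := measurable_fiber (measurable_never_below K).
have mu0 : mu (\bigcap_T Z T) = 0%E.
  apply/eqP; rewrite eq_le measure_ge0 andbT.
  apply: (@le_trans _ _ (mu (fiber (never_below K) `&` `]0, 1[)%classic%R)).
    2: by rewrite -massE// B0.
  by apply: le_measure; rewrite ?inE//; exact: measurableI_itv.
have Z0 : (mu (Z 0%N) < +oo)%E.
  by rewrite /Z -massE// ltry.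
have niZ : nonincreasing_seq Z.
  move=> m n mn; apply/subsetPset => x [[x0 [k [kM kn]]] x1].
  split => //; split => //; exists k; split => // i im.
  by apply: kn; exact: leq_trans mn.
have : mu \o Z @ \oo --> 0%E by rewrite -mu0; exact: nonincreasing_cvg_mu.
move=> /fine_cvgP[_]/cvgrPdist_le.
have e3 : 0 < e / 3 by rewrite divr_gt0.
move=> /(_ _ e3)[T _ /(_ T (leqnn T))] /=.
rewrite sub0r normrN -[fine _]/(mass (fiber (F T)) 1) ger0_norm ?mass_ge0// => hT.
exists T; exists (fiber (F T)); split => // r r0.
apply: (le_trans (mass_mul3_stable (mZ T) (@fiber_mul3 _ (F T)) r0 ltr01)).
by rewrite ler_pM2r// divr1; lra.
Qed.

End zero_one.

(** * Stopping times *)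

Section stopping.
Context {R : realType}.
Implicit Types (x y r t K a b : R) (n : nat).

Lemma stopping_time_leP K x t : (stopping_time K x <= t%:E)%E <->
  exists2 n, iter n collatzR x <= K & n%:R <= t.
Proof.
rewrite /stopping_time; case: pselect => [ex|nex]; last first.
  by split => [|[n xK _]]; [rewrite leye_eq|case: nex; exists n].
case: ex_minnP => m mK mmin; rewrite lee_fin; split => [mt|[n nK]].
  by exists m.
by apply: le_trans; rewrite ler_nat mmin.
Qed.

Lemma le_stopping_timeP K x t : (t%:E <= stopping_time K x)%E <->
  forall n, iter n collatzR x <= K -> t <= n%:R.
Proof.
rewrite /stopping_time; case: pselect => [ex|nex]; last first.
  by split => [_ n xK|_]; [case: nex; exists n|rewrite leey].
case: ex_minnP => m mK mmin; rewrite lee_fin; split => [mt n nK|]; last exact.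
by apply: (le_trans mt); rewrite ler_nat mmin.
Qed.

Lemma measurable_log2 : measurable_fun [set: R] (@log2 R).
Proof.
by apply: measurable_funM; [exact: measurable_ln|exact: measurable_cst].
Qed.

Lemma measurable_stopping_time K a b :
  measurable [set x : R | 3 / 4 < x /\
    (((a * log2 x)%:E <= stopping_time K x)%E /\
     (stopping_time K x <= (b * log2 x)%:E)%E)].
Proof.
have mlog c : measurable_fun [set: R] (fun x : R => c * log2 x).
  by apply: measurable_funM => //; exact: measurable_log2.
have mn n : measurable [set x : R | K < iter n collatzR x].
  exact: measurable_collatzR_gt.
rewrite (_ : [set _ | _] = `]3 / 4, +oo[ `&` (
    \bigcap_n ([set x | K < iter n collatzR x] `|`
      (fun x => a * log2 x) @^-1` `]-oo, n%:R]) `&`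
    \bigcup_n (~` [set x | K < iter n collatzR x] `&`
      (fun x => b * log2 x) @^-1` `[n%:R, +oo[))); last first.
  apply/seteqP; split => x /=; rewrite in_itv/= andbT.
    move=> [x34 [/le_stopping_timeP lo /stopping_time_leP[n nK nb]]].
    split => //; split.
      move=> m _; have [mK|mK] := ltP K (iter m collatzR x); [by left|right].
      by rewrite /= in_itv/= lo.
    by exists n => //; split; [apply/negP; rewrite -leNgt|rewrite /= in_itv/= nb].
  move=> [x34 [lo [n _ [/negP nK nb]]]]; split => //; split.
    apply/le_stopping_timeP => m mK; have [] := lo m I.
      by rewrite /= ltNge mK.
    by rewrite /= in_itv.
  apply/stopping_time_leP; exists n; first by rewrite leNgt.
  by move: nb; rewrite /= in_itv/= andbT.
apply: measurableI; first exact: measurable_itv.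
apply: measurableI.
  apply: bigcapT_measurable => n; apply: measurableU; first exact: mn.
  by apply: measurable_preimage (mlog a) _; exact: measurable_itv.
apply: bigcupT_measurable => n; apply: measurableI.
  by apply: measurableC; exact: mn.
by apply: measurable_preimage (mlog b) _; exact: measurable_itv.
Qed.

Lemma ln2_gt0 : 0 < ln 2 :> R.
Proof. by rewrite ln_gt0// ltr1n. Qed.

Lemma log2M x y : 0 < x -> 0 < y -> log2 (x * y) = log2 x + log2 y.
Proof. by move=> x0 y0; rewrite /log2 lnM// mulrDl. Qed.

Lemma log2X n : log2 (2 ^+ n) = n%:R :> R.
Proof.
by rewrite /log2 lnXn// -[_ *+ n]mulr_natl mulfK// gt_eqF// ln2_gt0.
Qed.

Lemma ler_log2 x y : 0 < x -> 0 < y -> (log2 x <= log2 y) = (x <= y).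
Proof.
by move=> x0 y0; rewrite /log2 ler_pM2r ?invr_gt0 ?ln2_gt0// ler_ln.
Qed.

Lemma log2_large (B : R) : exists2 r0 : R, 0 < r0 & forall r, r0 <= r -> B <= log2 r.
Proof.
exists (expR (B * ln 2)); first exact: expR_gt0.
move=> r rB; have r0 : 0 < r by apply: lt_le_trans rB; exact: expR_gt0.
apply: le_trans (_ : log2 (expR (B * ln 2)) <= _).
  by rewrite /log2 expRK mulfK// gt_eqF// ln2_gt0.
by rewrite ler_log2// expR_gt0.
Qed.

Local Notation drift := (1 - log2 (3 : R) / 2).

Lemma drift_itv : 0 < drift < 1.
Proof.
have h : 0 < log2 3 :> R by rewrite divr_gt0 ?ln2_gt0// ln_gt0// ltr1n.
by have := @log2_3_lt2 R; lra.
Qed.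

(** On [[delta * r, r[] the logarithms of [x] and [r] differ by a bounded amount, so one exceptional
    set, depending on [r], serves all these [x]. *)
Lemma early_stop_sparse K eps delta e : 0 < K -> 0 < eps -> 0 < delta -> 0 < e ->
  exists2 r0 : R, 0 < r0 & forall r, r0 <= r -> exists2 A : set R, sparse A e &
    forall x n, delta * r <= x < r -> iter n collatzR x <= K ->
      n%:R < (drift^-1 - eps) * log2 x -> A x.
Proof.
move=> K0 eps0 delta0 e0; have /andP[d0 d1] := drift_itv.
(* Half of [eps] is kept in reserve for additive constants; the maximum with 1 keeps [A] and [rho]
   positive. *)
pose A := Num.max 1 (drift^-1 - eps / 2).
have A1 : 1 <= A by rewrite le_max lexx.
have Ad : A * drift < 1.
  rewrite -ltr_pdivlMr// mul1r gt_max invf_gt1// d1/=; lra.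
have Aeps : drift^-1 - eps / 2 <= A by rewrite le_max lexx orbT.
have A0 : 0 < A by lra.
(* As [1 - rho] is the midpoint of [drift] and [A^-1], both [rho < log2 3 / 2] and
   [A * (1 - rho) < 1] follow. *)
pose rho := 1 - (drift + A^-1) / 2.
have dA : drift < A^-1 by rewrite -[ltRHS]mul1r ltr_pdivlMr// mulrC.
have A'1 : A^-1 <= 1 by rewrite invf_le1.
have rho01 : 0 < rho < 1 by rewrite /rho; apply/andP; split; lra.
have hrho : rho < log2 3 / 2 by rewrite /rho; move: dA; lra.
have Arho : A * (1 - rho) < 1.
  rewrite /rho opprB addrCA subrr addr0 mulrA mulrDr divff ?gt_eqF//; lra.
pose c := (Num.truncn K).+1.*2.+1.
have oc : odd c by rewrite /c /= odd_double.
have Kc : K < c%:R.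
  have /truncn_itv/andP[_ h] : 0 <= K by exact: ltW.
  by apply: (lt_le_trans h); rewrite ler_nat /c -addnn leqW ?leq_addr.
have c0 : 0 < c%:R :> R by exact: lt_trans Kc.
have [theta [C [t01 C0 [L1 H]]]] := sparse_fast_descent rho01 hrho (ltW A0) Arho oc.
have [N hN] := geometric_small t01 C0 e0.
pose L0 := maxn L1 N.
pose B1 := - log2 (delta / c%:R).
(* Beyond this threshold [eps / 2 * log2 r] absorbs [A] times the sum of [B1], the rounding of [L]
   and [L0]; the last term keeps [log2 r - B1] nonnegative. *)
pose B := 2 * A * (`|B1| + 1 + L0%:R) / eps + `|B1|.
have [r0 r00 hr0] := log2_large B.
exists r0 => // r rr0.
have rpos : 0 < r by exact: lt_le_trans rr0.
have dc0 : 0 < delta / c%:R by rewrite divr_gt0.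
have rB : B <= log2 r by exact: hr0.
have nB1 := ler_norm B1; have nB0 := normr_ge0 B1.
have Bge : `|B1| <= B.
  by rewrite /B lerDr divr_ge0 ?mulr_ge0 ?addr_ge0//; move: A0 eps0; clear; lra.
have u0 : 0 <= log2 r - B1 by lra.
(* The largest [L] with [c * 2 ^ L <= delta * r]. *)
pose L := Num.truncn (log2 r - B1).
have /andP[Lu uL] := truncn_itv u0.
have Lr : (c * 2 ^ L)%:R <= delta * r.
  rewrite natrM natrX mulrC -ler_pdivlMr// -ler_log2 ?exprn_gt0//; last first.
    by rewrite divr_gt0// mulr_gt0.
  rewrite log2X mulrAC log2M//.
  by move: Lu; rewrite /B1; lra.
exists [set x : R | 0 < x /\ exists k : int, (c * 2 ^ L)%:R <= 3 ^ k * x /\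
        exists n, n%:R <= A * (L%:R - L0%:R) /\
          iter n collatzR (3 ^ k * x) < c%:R].
  by apply: sparse_sub (H L0 L (leq_maxl _ _)) => //; apply: hN; exact: leq_maxr.
move=> x n /andP[xr1 xr2] nK nx.
have x0 : 0 < x by apply: lt_le_trans xr1; rewrite mulr_gt0.
split => //; exists 0; rewrite expr0z mul1r; split; first exact: le_trans xr1.
exists n; split; last exact: le_lt_trans Kc.
have x1 : 1 <= x.
  apply: le_trans xr1; apply: le_trans Lr.
  by rewrite ler1n muln_gt0 expn_gt0.
have lx0 : 0 <= log2 x.
  by rewrite divr_ge0 ?ln_ge0// ler1n.
have lxr : log2 x <= log2 r by rewrite ler_log2// ltW.
have nA : n%:R < (A - eps / 2) * log2 x.
  by apply: (lt_le_trans nx); rewrite ler_wpM2r//; clear -Aeps eps0; lra.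
have [As|As] := leP 0 (A - eps / 2); last first.
  have n0 : 0 <= n%:R :> R by [].
  by move: (le_lt_trans n0 nA); rewrite ltNge mulr_le0_ge0// ltW.
apply: le_trans (ltW nA) _; apply: le_trans (_ : (A - eps / 2) * log2 r <= _).
  by rewrite ler_wpM2l.
have uL' : log2 r - B1 - 1 <= L%:R.
  by move: uL; rewrite -/L -addn1 natrD; clear; lra.
have : A * (log2 r - B1 - 1 - L0%:R) <= A * (L%:R - L0%:R).
  by rewrite ler_pM2l//; move: uL'; clear; lra.
apply: le_trans.
have : 2 * A * (`|B1| + 1 + L0%:R) / eps <= log2 r.
  by rewrite /B in rB; move: rB nB0; clear; lra.
rewrite ler_pdivrMr//.
have : A * B1 <= A * `|B1| by rewrite ler_pM2l.
by clear; lra.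
Qed.

(** Two phases: [sparse_descent] leads below [2 ^+ L0] in at most [A * L] steps, with [L] close to
    [log2 r], then [sparse_late] leads to [K] in at most [T] more. A late point is exceptional for
    one of them. *)
Lemma late_stop_sparse K eps delta e : 0 < K -> 0 < eps -> 0 < delta -> 0 < e ->
  (forall r, mass (fiber (never_below K)) r = 0) ->
  exists2 r0 : R, 0 < r0 & forall r, r0 <= r -> exists2 A : set R, sparse A e &
    forall x, delta * r <= x < r ->
      (forall n, n%:R <= (drift^-1 + eps) * log2 x -> K < iter n collatzR x) -> A x.
Proof.
move=> K0 eps0 delta0 e0 BK; have /andP[d0 d1] := drift_itv.
pose A := drift^-1 + eps / 2.
have di0 : 0 < drift^-1 by rewrite invr_gt0.
have A0 : 0 < A by rewrite /A; lra.
have Ad : 1 < A * drift.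
  by rewrite /A mulrDl mulVf ?gt_eqF// ltrDl mulr_gt0// divr_gt0.
pose rho := 1 - (drift + A^-1) / 2.
have dA : A^-1 < drift by rewrite -[ltLHS]mul1r ltr_pdivrMr// mulrC.
have A'0 : 0 < A^-1 by rewrite invr_gt0.
have hrho : log2 3 / 2 < rho < 1.
  by move: dA d0 A'0; rewrite /rho => *; apply/andP; split; lra.
have Arho : 1 < A * (1 - rho).
  rewrite /rho opprB addrCA subrr addr0 mulrA mulrDr divff ?gt_eqF//; lra.
have [theta [C [t01 C0 [L1 H]]]] := sparse_descent hrho Arho.
have e2 : 0 < e / 2 by rewrite divr_gt0.
have [N hN] := geometric_small t01 C0 e2.
pose L0 := maxn L1 N.
have M0 : 0 < 2 ^+ L0 :> R by rewrite exprn_gt0.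
have [T sT] := sparse_late K0 M0 e2 BK.
(* Makes [eps / 2 * log2 r] cover the [T] final steps, the rounding of [L] and the gap between
   [log2 x] and [log2 r]. *)
pose B := 2 * (T%:R + A + (A + eps / 2) * `|log2 delta|) / eps.
have [r0 r00 hr0] := log2_large B.
exists r0 => // r rr0.
have rpos : 0 < r by exact: lt_le_trans rr0.
have rB : B <= log2 r by exact: hr0.
have nd0 := normr_ge0 (log2 delta).
have nd1 : - log2 delta <= `|log2 delta| by rewrite -normrN ler_norm.
have ld : A * - log2 delta <= A * `|log2 delta| by rewrite ler_pM2l.
have le' : eps * - log2 delta <= eps * `|log2 delta| by rewrite ler_pM2l.
have B0 : 0 <= B.
  rewrite divr_ge0 ?mulr_ge0 ?addr_ge0 ?mulr_ge0//;
    by move: A0 di0 eps0; clear; lra.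
have lr0 : 0 <= log2 r by exact: le_trans rB.
have /truncn_itv/andP[L1r L2r] := lr0.
set L := (Num.truncn (log2 r)).+1 in L2r.
have L3r : L%:R <= log2 r + 1 by rewrite /L -addn1 natrD lerD2r.
have [n nA sV] := H L0 L (leq_maxl _ _).
set V := (X in sparse X _) in sV.
set Z := (X in sparse X _) in sT.
have p2 : 0 < 2 ^+ n :> R by rewrite exprn_gt0.
exists (V `|` (fun x => x / 2 ^+ n) @^-1` Z).
  apply: sparse_sub (sparseU sV (sparse_scale p2 sT)) => //.
  by have := hN L0 (leq_maxr _ _); clear; lra.
move=> x /andP[xr1 xr2] xK.
have x0 : 0 < x by apply: lt_le_trans xr1; rewrite mulr_gt0.
have xL : x < 2 ^+ L.
  apply: (lt_le_trans xr2); rewrite -ler_log2 ?exprn_gt0// log2X; exact: ltW.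
have [xV|xV] := leP (2 ^+ L0) (iter n collatzR x).
  by left; split => //; exists 0; rewrite expr0z mul1r.
right; split; first by rewrite divr_gt0.
exists (odd_steps n x)%:Z; rewrite -exprnP mulrA -iter_collatzRE; split => // m mT.
rewrite -iterD; apply: xK.
have lx : log2 delta + log2 r <= log2 x.
  by rewrite -log2M// ler_log2// mulr_gt0.
apply: le_trans (_ : (A + eps / 2) * (log2 delta + log2 r) <= _); last first.
  have -> : drift^-1 + eps = A + eps / 2 by rewrite /A; clear; lra.
  by rewrite ler_pM2l//; move: A0 eps0; clear; lra.
have mTR : m%:R <= T%:R :> R by rewrite ler_nat.
have AL : A * L%:R <= A * (log2 r + 1) by rewrite ler_pM2l.
rewrite natrD.
move: rB; rewrite /B ler_pdivrMr//.
by move: nA AL mTR ld le'; clear; lra.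
Qed.

End stopping.

Theorem theorem1p7 (R : realType) :
  exists2 K : R, 0 < K &
    forall eps : R, 0 < eps ->
      has_real_density
        [set x : R | 3 / 4 < x /\
           ((((1 - log2 3 / 2)^-1 - eps) * log2 x)%:E <= stopping_time K x)%E /\
           (stopping_time K x <= (((1 - log2 3 / 2)^-1 + eps) * log2 x)%:E)%E]
        1.
Proof.
have [L0 BK] := @exists_never_below_null R.
have K0 : 0 < 2 ^+ L0 :> R by rewrite exprn_gt0.
exists (2 ^+ L0) => // eps eps0; split; first exact: measurable_stopping_time.
move=> eta eta0; set Q := [set x | _].
have mQ : measurable Q by exact: measurable_stopping_time.
(* Three exceptional sets, each of mass at most [e * r], cost [3 * eta / 8 < eta / 2] in density. *)
pose e := eta / 8; have e0 : 0 < e by rewrite divr_gt0.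
have [r1 r10 H1] := early_stop_sparse K0 eps0 e0 e0.
have [r2 r20 H2] := late_stop_sparse K0 eps0 e0 e0 BK.
(* The term [e^-1] ensures [1 <= e * r], so that points from [e * r] on exceed 3/4. *)
pose r0 := r1 + r2 + e^-1.
have e'0 : 0 < e^-1 by rewrite invr_gt0.
exists r0 => [|r rr0]; first by rewrite /r0; lra.
have rpos : 0 < r by rewrite /r0 in rr0; lra.
have [|A1 [A1' [mA1 AA1 hA1]] HA1] := H1 r; first by rewrite /r0 in rr0; lra.
have [|A2 [A2' [mA2 AA2 hA2]] HA2] := H2 r; first by rewrite /r0 in rr0; lra.
have er1 : 1 <= e * r.
  by rewrite -ler_pdivrMl// mulr1; rewrite /r0 in rr0; lra.
have er0 : 0 <= e * r by lra.
rewrite -/(mass Q r) -(@mass_setT R r (ltW rpos)).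
have mI : measurable (`]0, e * r[ : set R) by exact: measurable_itv.
have cover : r <= mass (Q `|` (`]0, e * r[ `|` (A1' `|` A2'))) r.
  rewrite -[leLHS](mass_setT (ltW rpos)); apply: le_mass => //.
    by do ! apply: measurableU.
  move=> x [_]; rewrite /= in_itv/= => /andP[x0 xr]; rewrite x0 xr; split => //.
  have [xe|xe] := ltP x (e * r).
    by right; left; rewrite /= in_itv/= x0.
  have xer : e * r <= x < r by rewrite xe.
  have [lo|/le_stopping_timeP/existsNP[n /not_implyP[nK nlo]]] :=
    pselect (((((1 - log2 3 / 2)^-1 - eps) * log2 x)%:E <=
              stopping_time (2 ^+ L0) x)%E).
    have [hi|/stopping_time_leP hi] :=
      pselect ((stopping_time (2 ^+ L0) x <=
                (((1 - log2 3 / 2)^-1 + eps) * log2 x)%:E)%E).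
      by left; split => //; lra.
    right; right; right; apply/AA2/HA2 => // n nhi; rewrite ltNge; apply/negP => nK.
    by apply: hi; exists n.
  right; right; left; apply/AA1/(HA1 x n) => //.
  by rewrite ltNge; apply/negP.
have h1 := massU r mQ (measurableU _ _ mI (measurableU _ _ mA1 mA2)).
have h2 := massU r mI (measurableU _ _ mA1 mA2).
have h3 := massU r mA1 mA2.
have h4 := hA1 r rpos; have h5 := hA2 r rpos.
have h6 : mass (`]0, e * r[ : set R) r <= e * r.
  rewrite -[leRHS]mass_setT//; apply: le_mass => //.
  by move=> x [xI _]; split.
have h7 := mass_le mQ (ltW rpos).
rewrite mass_setT ?ltW//.
have h8 : mass Q r / r <= 1 by rewrite ler_pdivrMr// mul1r.
have h9 : 1 - eta / 2 <= mass Q r / r.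
  by rewrite ler_pdivlMr//; rewrite /e in h4 h5 h6; lra.
by rewrite ltr_norml; apply/andP; split; lra.
Qed.
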